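(* Let $K$ be a commutative ring with unit and let $(V,G)$ be a representation over $K$. Then $$\mathcal{L}\mathcal{Q}^0\mathcal{Q}^r\mathcal{S}\mathcal{C}(V,G)=qVar_{a.t.}(V,G)$$ if and only if $(V,G)$ is an action type logically Noetherian representation.
   Context: A representation $(V,G)$ over $K$ is a group $G$ together with a right $KG$-module $V$ (action written $v\circ g$). A homomorphism of representations $(\alpha,\beta):(V,G)\to(W,H)$ is a $K$-module homomorphism $\alpha:V\to W$ together with a group homomorphism $\beta:G\to H$ such that $(v\circ g)^\alpha=v^\alpha\circ g^\beta$. A subrepresentation $(V_0,G_0)\le(V,G)$ consists of a subgroup $G_0\le G$ and a $K$-submodule $V_0\le V$ that is a $KG_0$-submodule. $(V,G)$ is finitely generated if $G$ is a finitely generated group and $V$ is a finitely generated $KG$-module. For finite sets $X,Y$ let $F(Y)$ be the free group on $Y$, $XKF(Y)=\bigoplus_{x\in X}xKF(Y)$ the free right $KF(Y)$-module with basis $X$, and $W(X,Y)=(XKF(Y),F(Y))$. For $T\subset XKF(Y)$ put $T^{\nabla}_{(V,G)}=\{(\alpha,\beta)\in\mathrm{Hom}(W(X,Y),(V,G))\mid \ker\alpha\supset T\}$ and $T^{\nabla\nabla}_{(V,G)}=\bigcap_{(\alpha,\beta)\in T^{\nabla}_{(V,G)}}\ker\alpha$. $(V,G)$ is action type logically Noetherian if for all finite $X,Y$, every $T\subset XKF(Y)$ and every $w\in T^{\nabla\nabla}_{(V,G)}$ there is a finite $T_0\subset T$ with $w\in(T_0)^{\nabla\nabla}_{(V,G)}$.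 An action type quasi-identity is a formula $\left(\bigwedge_{i=1}^n(w_i=0)\right)\Rightarrow(w_0=0)$ with $w_0,\dots,w_n\in XKF(Y)$, $X,Y$ finite; $(V,G)$ satisfies it if $w_0^\alpha=0$ for every $(\alpha,\beta)\in\mathrm{Hom}(W(X,Y),(V,G))$ with $w_i^\alpha=0$ for $i=1,\dots,n$. $qVar_{a.t.}(V,G)$ is the class of all representations over $K$ satisfying every action type quasi-identity satisfied by $(V,G)$. Operators on a class $\mathfrak X$ of representations over $K$ (classes and operators are understood up to isomorphism): $\mathcal{C}\mathfrak X$ = all Cartesian products $(\prod_{i\in I}V_i,\prod_{i\in I}G_i)$, with componentwise action, of families of members of $\mathfrak X$; $\mathcal{S}\mathfrak X$ = all subrepresentations of members of $\mathfrak X$; $(V,G)\in\mathcal{Q}^r\mathfrak X$ iff there are $(V,D)\in\mathfrak X$ and a group epimorphism $\varphi:D\to G$ such that $(\mathrm{id}_V,\varphi):(V,D)\to(V,G)$ is a homomorphism of representations; $(V,G)\in\mathcal{Q}^0\mathfrak X$ iff there are $(V,D)\in\mathfrak X$ and a group epimorphism $\varphi:G\to D$ such that $(\mathrm{id}_V,\varphi):(V,G)\to(V,D)$ is a homomorphism of representations; $(V,G)\in\mathcal{L}\mathfrak X$ iff every finitely generated subrepresentation of $(V,G)$ belongs to $\mathfrak X$. Products of operators are compositions, applied from right to left, and an operator applied to $(V,G)$ means applied to the class $\{(V,G)\}$. *)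

(* Defs.v *)
From HB Require Import structures.
From mathcomp Require Import all_boot all_algebra.
From mathcomp Require Import boolp classical_sets functions cardinality.

Set Implicit Arguments.
Unset Strict Implicit.
Unset Printing Implicit Defensive.

Import GRing.Theory.
Local Open Scope classical_set_scope.
Local Open Scope ring_scope.

(* A right KG-module structure on the K-module V is the same thing as a right
   action of the group G on V by K-linear maps. *)
Record raction (K : comPzRingType) (V : lmodType K) (G : groupType) := RAction {
  act_fun :> V -> G -> V;
  act_linear : forall g, linear (act_fun ^~ g);
  act1 : forall v, act_fun v 1%g = v;
  actM : forall v g h, act_fun v (g * h)%g = act_fun (act_fun v g) h }.

Record representation (K : comPzRingType) := Representation {
  rmod : lmodType K;
  rgrp : groupType;
  ract : raction rmod rgrp }.

Arguments Representation {K rmod rgrp} ract.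

Record rep_hom (K : comPzRingType) (R S : representation K) := RepHom {
  hmod : {linear rmod R -> rmod S};
  hgrp : UMagmaMorphism.type (rgrp R) (rgrp S);
  hom_act : forall v g, hmod (ract R v g) = ract S (hmod v) (hgrp g) }.

Definition rep_iso (K : comPzRingType) (R S : representation K) : Prop :=
  exists f : rep_hom R S, bijective (hmod f) /\ bijective (hgrp f).

(* Subrepresentations. Submodules and subgroups are boolean predicates; since
   boolp provides excluded middle and extensionality, these are the same as
   arbitrary subsets. *)

Section SubModule.
Variables (K : comPzRingType) (V : lmodType K) (A : submodClosed V).

Definition submodule : Type := {v : V | v \in A}.

HB.instance Definition _ := [isSub of submodule for @sval _ _].
HB.instance Definition _ := [Choice of submodule by <:].
HB.instance Definition _ := [SubChoice_isSubLmodule of submodule by <:].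
End SubModule.

Section SubGroup.
Variables (G : groupType) (B : groupClosed G).

Definition subgroup : Type := {g : G | g \in B}.

Fact subgroup_closed : group_closed B.
Proof. by split; [exact: gpred1 | exact: gpredF]. Qed.

HB.instance Definition _ := [isSub of subgroup for @sval _ _].
HB.instance Definition _ := [Choice of subgroup by <:].
HB.instance Definition _ :=
  SubChoice_isSubGroup.Build G _ subgroup subgroup_closed.
End SubGroup.

Definition act_stable (K : comPzRingType) (V : lmodType K) (G : groupType)
    (a : raction V G) (A : {pred V}) (B : {pred G}) : Prop :=
  forall v g, v \in A -> g \in B -> a v g \in A.

Record subrep (K : comPzRingType) (R : representation K) := SubRep {
  smod : submodClosed (rmod R);
  sgrp : groupClosed (rgrp R);
  smod_stable : act_stable (ract R) smod sgrp }.

Section SubRepresentation.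
Variables (K : comPzRingType) (R : representation K) (S : subrep R).

Definition subrep_act (v : submodule (smod S)) (g : subgroup (sgrp S)) :
    submodule (smod S) :=
  exist _ (ract R (val v) (val g)) (smod_stable (valP v) (valP g)).

Fact subrep_act_linear g : linear (subrep_act ^~ g).
Proof.
by move=> k u v; apply: val_inj; rewrite /= act_linear.
Qed.

Fact subrep_act1 v : subrep_act v 1%g = v.
Proof. by apply: val_inj; rewrite /= act1. Qed.

Fact subrep_actM v g h :
  subrep_act v (g * h)%g = subrep_act (subrep_act v g) h.
Proof. by apply: val_inj; rewrite /= actM. Qed.

Definition rep_of_subrep : representation K :=
  Representation (RAction subrep_act_linear subrep_act1 subrep_actM).
End SubRepresentation.

Section CartesianProduct.
Variables (K : comPzRingType) (I : Type) (F : I -> representation K).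

Definition mod_prod : Type := forall i, rmod (F i).
Definition grp_prod : Type := forall i, rgrp (F i).

HB.instance Definition _ := Choice.on mod_prod.
HB.instance Definition _ := Choice.on grp_prod.

Fact mod_prod_addA : associative (fun u v : mod_prod => fun i => u i + v i).
Proof. by move=> u v w; apply: functional_extensionality_dep => i; exact: addrA. Qed.
Fact mod_prod_addC : commutative (fun u v : mod_prod => fun i => u i + v i).
Proof. by move=> u v; apply: functional_extensionality_dep => i; exact: addrC. Qed.
Fact mod_prod_add0 :
  left_id (fun i => 0 : rmod (F i)) (fun u v : mod_prod => fun i => u i + v i).
Proof. by move=> u; apply: functional_extensionality_dep => i; exact: add0r. Qed.
Fact mod_prod_addN :
  left_inverse (fun i => 0 : rmod (F i)) (fun u : mod_prod => fun i => - u i)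
    (fun u v : mod_prod => fun i => u i + v i).
Proof. by move=> u; apply: functional_extensionality_dep => i; exact: addNr. Qed.

HB.instance Definition _ := GRing.isZmodule.Build mod_prod
  mod_prod_addA mod_prod_addC mod_prod_add0 mod_prod_addN.

Definition mod_prod_scale (k : K) (u : mod_prod) : mod_prod :=
  fun i => k *: u i.

Fact mod_prod_scaleA a b v :
  mod_prod_scale a (mod_prod_scale b v) = mod_prod_scale (a * b) v.
Proof. by apply: functional_extensionality_dep => i; exact: scalerA. Qed.
Fact mod_prod_scale1 : left_id 1 mod_prod_scale.
Proof. by move=> u; apply: functional_extensionality_dep => i; exact: scale1r. Qed.
Fact mod_prod_scaleDr : right_distributive mod_prod_scale +%R.
Proof. by move=> a u v; apply: functional_extensionality_dep => i; exact: scalerDr. Qed.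
Fact mod_prod_scaleDl v : {morph mod_prod_scale^~ v : a b / a + b}.
Proof. by move=> a b; apply: functional_extensionality_dep => i; exact: scalerDl. Qed.

HB.instance Definition _ := GRing.Zmodule_isLmodule.Build K mod_prod
  mod_prod_scaleA mod_prod_scale1 mod_prod_scaleDr mod_prod_scaleDl.

Fact grp_prod_mulA :
  associative (fun g h : grp_prod => fun i => (g i * h i)%g).
Proof. by move=> f g h; apply: functional_extensionality_dep => i; exact: mulgA. Qed.
Fact grp_prod_mul1 :
  left_id (fun i => 1%g : rgrp (F i))
    (fun g h : grp_prod => fun i => (g i * h i)%g).
Proof. by move=> g; apply: functional_extensionality_dep => i; exact: mul1g. Qed.
Fact grp_prod_mulr1 :
  right_id (fun i => 1%g : rgrp (F i))
    (fun g h : grp_prod => fun i => (g i * h i)%g).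
Proof. by move=> g; apply: functional_extensionality_dep => i; exact: mulg1. Qed.
Fact grp_prod_mulV :
  left_inverse (fun i => 1%g : rgrp (F i))
    (fun g : grp_prod => fun i => (g i)^-1%g)
    (fun g h : grp_prod => fun i => (g i * h i)%g).
Proof. by move=> g; apply: functional_extensionality_dep => i; exact: mulVg. Qed.
Fact grp_prod_mulgV :
  right_inverse (fun i => 1%g : rgrp (F i))
    (fun g : grp_prod => fun i => (g i)^-1%g)
    (fun g h : grp_prod => fun i => (g i * h i)%g).
Proof. by move=> g; apply: functional_extensionality_dep => i; exact: mulgV. Qed.

HB.instance Definition _ := isGroup.Build grp_prod
  grp_prod_mulA grp_prod_mul1 grp_prod_mulr1 grp_prod_mulV grp_prod_mulgV.

Definition prod_act (v : mod_prod) (g : grp_prod) : mod_prod :=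
  fun i => ract (F i) (v i) (g i).

Fact prod_act_linear g : linear (prod_act ^~ g).
Proof. by move=> k u v; apply: functional_extensionality_dep => i; exact: act_linear. Qed.
Fact prod_act1 v : prod_act v 1%g = v.
Proof. by apply: functional_extensionality_dep => i; exact: act1. Qed.
Fact prod_actM v g h : prod_act v (g * h)%g = prod_act (prod_act v g) h.
Proof. by apply: functional_extensionality_dep => i; exact: actM. Qed.

Definition rep_prod : representation K :=
  Representation (RAction prod_act_linear prod_act1 prod_actM).
End CartesianProduct.

Definition fin_gen_group (G : groupType) : Prop :=
  exists s : seq G, forall B : groupClosed G,
    {subset s <= B} -> forall g, g \in B.

Definition fin_gen_rep (K : comPzRingType) (R : representation K) : Prop :=
  fin_gen_group (rgrp R) /\
  exists s : seq (rmod R), forall A : submodClosed (rmod R),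
    act_stable (ract R) A predT -> {subset s <= A} -> forall v, v \in A.

(* The free group on Y, realized by reduced words: the letter (y, true) stands
   for y and (y, false) for its inverse. *)
Section FreeGroup.
Variable Y : choiceType.
Implicit Types (a b : Y * bool) (s t : seq (Y * bool)).

Definition letter_inv a : Y * bool := (a.1, ~~ a.2).

Definition reduced s : bool := sorted (fun a b => b != letter_inv a) s.

Definition letter_mul a s : seq (Y * bool) :=
  if s is b :: s' then if b == letter_inv a then s' else a :: s else [:: a].

Definition word_mul s t : seq (Y * bool) := foldr letter_mul t s.

Definition word_inv s : seq (Y * bool) := rev (map letter_inv s).

Fact letter_invK : involutive letter_inv.
Proof. by case=> y b; rewrite /letter_inv /= negbK. Qed.

Fact reduced_letter_mul a s : reduced s -> reduced (letter_mul a s).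
Proof.
case: s => [|b s] //= red_s; case: ifPn => [_|nab] /=; first exact: path_sorted red_s.
by rewrite nab.
Qed.

Fact reduced_word_mul s t : reduced t -> reduced (word_mul s t).
Proof. by move=> red_t; elim: s => //= a s; exact: reduced_letter_mul. Qed.

Fact reduced_word_inv s : reduced s -> reduced (word_inv s).
Proof.
rewrite /reduced /word_inv rev_sorted sorted_map; apply: sub_sorted => a b /=.
by apply: contra => /eqP ->; rewrite letter_invK.
Qed.

Fact letter_mulK a s : reduced s -> letter_mul a (letter_mul (letter_inv a) s) = s.
Proof.
case: s => [|b s] /=; first by rewrite eqxx.
rewrite letter_invK; have [->|nba] := eqVneq b a; last by rewrite /= eqxx.
by case: s => //= c s /andP[/negPf->].
Qed.

Fact word_mulA s t u : reduced u -> reduced t ->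
  word_mul s (word_mul t u) = word_mul (word_mul s t) u.
Proof.
move=> red_u red_t; elim: s => //= a s ->.
have := reduced_word_mul s red_t; case: (word_mul s t) => //= b w red_w.
case: eqP => [->|//]; rewrite letter_mulK //; exact: reduced_word_mul.
Qed.

Fact word_mulr1 s : reduced s -> word_mul s [::] = s.
Proof.
elim: s => //= a s IHs red_s; rewrite IHs; last exact: path_sorted red_s.
by case: s red_s {IHs} => //= b s /andP[/negPf->].
Qed.

Fact word_mulV s : reduced s -> word_mul (word_inv s) s = [::].
Proof.
elim: s => //= a s IHs red_s; rewrite /word_inv /= rev_cons /word_mul foldr_rcons /=.
by rewrite letter_invK eqxx; apply: IHs; exact: path_sorted red_s.
Qed.

Fact word_invK : involutive word_inv.
Proof.
move=> s; rewrite /word_inv map_rev revK -map_comp map_id_in // => a _ /=.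
exact: letter_invK.
Qed.

Definition free_group : Type := {s : seq (Y * bool) | reduced s}.

HB.instance Definition _ := [isSub of free_group for @sval _ _].
HB.instance Definition _ := [Choice of free_group by <:].

Definition free_one : free_group := exist _ [::] isT.
Definition free_mul (f g : free_group) : free_group :=
  exist _ (word_mul (val f) (val g)) (reduced_word_mul (val f) (valP g)).
Definition free_inv (f : free_group) : free_group :=
  exist _ (word_inv (val f)) (reduced_word_inv (valP f)).

Fact free_mulA : associative free_mul.
Proof. by move=> f g h; apply: val_inj; apply: word_mulA; exact: valP. Qed.
Fact free_mul1 : left_id free_one free_mul.
Proof. by move=> f; apply: val_inj. Qed.
Fact free_mulr1 : right_id free_one free_mul.
Proof. by move=> f; apply: val_inj; apply: word_mulr1; exact: valP. Qed.
Fact free_mulV : left_inverse free_one free_inv free_mul.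
Proof. by move=> f; apply: val_inj; apply: word_mulV; exact: valP. Qed.
Fact free_mulgV : right_inverse free_one free_inv free_mul.
Proof.
move=> f; apply: val_inj.
by have := word_mulV (reduced_word_inv (valP f)); rewrite word_invK.
Qed.

HB.instance Definition _ := isGroup.Build free_group
  free_mulA free_mul1 free_mulr1 free_mulV free_mulgV.
End FreeGroup.

(* XKF(Y): as a K-module it is free with basis the products x f for x in X and
   f in F(Y), so its elements are the finitely supported functions u on
   X * F(Y), u (x, f) being the coefficient of x f. Right multiplication by g
   sends x f to x (f g). *)
Section FreeRepresentation.
Variables (K : comPzRingType) (X Y : finType).

Definition fin_supp : {pred X * free_group Y -> K^o} :=
  fun u => `[< finite_set [set p | u p != 0] >].

Fact fin_supp_closed : submod_closed fin_supp.
Proof.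
split=> [|k u v /asboolP fin_u /asboolP fin_v]; apply/asboolP.
  by apply: (sub_finite_set _ (finite_set0 _)) => p /=; rewrite eqxx.
have : finite_set ([set p | u p != 0] `|` [set p | v p != 0]) by rewrite finite_setU.
apply: sub_finite_set => p /=.
have [|nz_u] := eqVneq (u p) 0; last by left.
have [|nz_v] := eqVneq (v p) 0; last by right.
move=> v0 u0; have -> : (k *: u + v) p = k *: u p + v p by [].
by rewrite u0 v0 scaler0 addr0 eqxx.
Qed.

HB.instance Definition _ :=
  GRing.isSubmodClosed.Build K (X * free_group Y -> K^o) fin_supp fin_supp_closed.

Definition free_module : lmodType K := submodule fin_supp.

Fact fin_supp_shift (u : X * free_group Y -> K^o) (g : free_group Y) :
  u \in fin_supp -> (fun p => u (p.1, p.2 * g^-1)%g) \in fin_supp.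
Proof.
move=> /asboolP fin_u; apply/asboolP.
apply: sub_finite_set (finite_image (fun p => (p.1, p.2 * g)%g) fin_u) => -[x f] /= nz.
by exists (x, f * g^-1)%g => //=; rewrite -mulgA mulVg mulg1.
Qed.

Definition free_act (u : free_module) (g : free_group Y) : free_module :=
  exist _ (fun p => val u (p.1, p.2 * g^-1)%g) (fin_supp_shift g (valP u)).

Fact free_act_linear g : linear (free_act ^~ g).
Proof. by move=> k u v; apply: val_inj. Qed.
Fact free_act1 u : free_act u 1%g = u.
Proof.
by apply: val_inj; apply/funext => -[x f] /=; rewrite invg1 mulg1.
Qed.
Fact free_actM u g h : free_act u (g * h)%g = free_act (free_act u g) h.
Proof.
by apply: val_inj; apply/funext => -[x f] /=; rewrite invgM mulgA.
Qed.

Definition free_rep : representation K :=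
  Representation (RAction free_act_linear free_act1 free_actM).
End FreeRepresentation.

Definition nabla (K : comPzRingType) (X Y : finType) (R : representation K)
    (T : set (free_module K X Y)) : set (rep_hom (free_rep K X Y) R) :=
  [set f : rep_hom (free_rep K X Y) R | forall w, T w -> hmod f w = 0].

Arguments nabla {K X Y} R T.

Definition nabla2 (K : comPzRingType) (X Y : finType) (R : representation K)
    (T : set (free_module K X Y)) : set (free_module K X Y) :=
  \bigcap_(f in nabla R T) [set w | hmod f w = 0].

Definition action_type_logically_Noetherian (K : comPzRingType)
    (R : representation K) : Prop :=
  forall (X Y : finType) (T : set (free_module K X Y)) (w : free_module K X Y),
    nabla2 R T w ->
    exists T0 : set (free_module K X Y),
      [/\ T0 `<=` T, finite_set T0 & nabla2 R T0 w].

(* The formula (/\_(i < n) qi_prem i = 0) => (qi_concl = 0). *)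
Record quasi_identity (K : comPzRingType) := QuasiIdentity {
  qi_X : finType;
  qi_Y : finType;
  qi_size : nat;
  qi_prem : 'I_qi_size -> free_module K qi_X qi_Y;
  qi_concl : free_module K qi_X qi_Y }.

Arguments qi_prem {K} q i.

Definition satisfies (K : comPzRingType) (R : representation K)
    (q : quasi_identity K) : Prop :=
  forall f : rep_hom (free_rep K (qi_X q) (qi_Y q)) R,
    (forall i, hmod f (qi_prem q i) = 0) -> hmod f (qi_concl q) = 0.

(* Not [set (representation K)]: a class lives in a universe above that of the
   carriers of its members. *)
Definition rep_class (K : comPzRingType) := representation K -> Prop.

Definition qVar_at (K : comPzRingType) (R : representation K) : rep_class K :=
  fun S => forall q : quasi_identity K, satisfies R q -> satisfies S q.

(* Classes are understood up to isomorphism: the starting class contains all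
   isomorphic copies of R, and each operator below maps classes closed under
   isomorphism to such classes. *)
Section Operators.
Variable K : comPzRingType.
Implicit Types (X : rep_class K) (R S : representation K).

Definition class_of_rep R : rep_class K := fun S => rep_iso S R.

Definition opC X : rep_class K := fun S =>
  exists (I : Type) (F : I -> representation K),
    (forall i, X (F i)) /\ rep_iso S (rep_prod F).

Definition opS X : rep_class K := fun S =>
  exists (R : representation K) (R0 : subrep R),
    X R /\ rep_iso S (rep_of_subrep R0).

Definition opQr X : rep_class K := fun S =>
  exists (D : groupType) (a : raction (rmod S) D)
         (phi : UMagmaMorphism.type D (rgrp S)),
    [/\ X (Representation a),
        forall g, exists d, phi d = g
      & forall v d, a v d = ract S v (phi d)].

Definition opQ0 X : rep_class K := fun S =>
  exists (D : groupType) (a : raction (rmod S) D)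
         (phi : UMagmaMorphism.type (rgrp S) D),
    [/\ X (Representation a),
        forall d, exists g, phi g = d
      & forall v g, ract S v g = a v (phi g)].

Definition opL X : rep_class K := fun S =>
  forall S0 : subrep S,
    fin_gen_rep (rep_of_subrep S0) -> X (rep_of_subrep S0).
End Operators.

(* Main.v *)
(* Write [W] for the free representation on finite sets [X], [Y]. Every implication
   "[T = 0] implies [w = 0]" with [T] a possibly infinite subset of [W] passes from
   [V] to the members of L Q0 Qr S C (V): for Qr because a homomorphism on a free
   group lifts along an epimorphism, for L because the image of [W] is finitely
   generated. Taking [T] finite gives the inclusion in qVar (V).

   If [V] is Noetherian and [S] is in qVar (V), cover a finitely generated
   subrepresentation [S0] by some [W], with kernel [T] on modules. Any [w] outside
   [T] is separated from [T] by a homomorphism to [V], since otherwise finitely many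
   elements of [T] would imply [w] in [V], hence in [S0]. So [T] is also the kernel
   of the map from [W] to a power of [V], and [S0] differs from the image of that
   map only in the kernel of the group action.

   Conversely, let [T'] be the set of consequences in [V] of finite subsets of [T].
   Lifting homomorphisms through the projection shows that [W / T'] is in qVar (V).
   If this is L Q0 Qr S C (V), then [W / T'] satisfies "[T = 0] implies [w = 0]"
   whenever [V] does, that is, [w] is in [T']. *)

From HB Require Import structures.
Require Import Defs.
From mathcomp Require Import all_boot all_algebra.
From mathcomp Require Import boolp classical_sets functions cardinality fsbigop.
From mathcomp Require Import finmap.

Set Implicit Arguments.
Unset Strict Implicit.
Unset Printing Implicit Defensive.

Import GRing.Theory.
Local Open Scope classical_set_scope.
Local Open Scope ring_scope.

(** * Free groups and free representations *)

Definition linear_pack (K : comPzRingType) (U V : lmodType K) (f : U -> V)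
    (fL : linear f) : {linear U -> V} :=
  HB.pack f (GRing.isLinear.Build K U V *:%R f fL).

(** [isGroupMorphism] asks for compatibility with division; between groups this follows from
    multiplicativity by cancelling [f y]. *)
Fact morphM_divg (G H : groupType) (f : G -> H) :
  {morph f : x y / (x * y)%g} -> {morph f : x y / (x / y)%g}.
Proof.
move=> fM x y.
by apply: (mulIg (f y)); rewrite -fM -!mulgA !mulVg !mulg1.
Qed.

Definition morph_pack (G H : groupType) (f : G -> H)
    (fM : {morph f : x y / (x * y)%g}) : UMagmaMorphism.type G H :=
  HB.pack f (isGroupMorphism.Build G H f (morphM_divg fM)).

Lemma act0 (K : comPzRingType) (V : lmodType K) (G : groupType) (a : raction V G) g :
  a 0 g = 0.
Proof. exact: (linear0 (linear_pack (act_linear a g))). Qed.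

Section Homomorphisms.
Variable K : comPzRingType.
Implicit Types R S P : representation K.

Definition hom_pack R S (f : rmod R -> rmod S) (g : rgrp R -> rgrp S)
    (fL : linear f) (gM : {morph g : x y / (x * y)%g})
    (fg : forall v h, f (ract R v h) = ract S (f v) (g h)) : rep_hom R S :=
  @RepHom K R S (linear_pack fL) (morph_pack gM) fg.

Lemma hom_comp_act R S P (f : rep_hom S P) (g : rep_hom R S) v h :
  (hmod f \o hmod g) (ract R v h)
  = ract P ((hmod f \o hmod g) v) ((hgrp f \o hgrp g) h).
Proof. by rewrite /= !hom_act. Qed.

Definition hom_comp R S P (f : rep_hom S P) (g : rep_hom R S) : rep_hom R P :=
  @RepHom K R P (hmod f \o hmod g) (hgrp f \o hgrp g) (hom_comp_act f g).
End Homomorphisms.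

Section FreeGroupUniversal.
Variable Y : choiceType.

Definition free_gen (y : Y) : free_group Y := exist _ [:: (y, true)] isT.

(** A reduced word is the product of its letters, each a generator or the inverse of one. *)
Lemma free_group_ind (P : free_group Y -> Prop) :
    P 1%g -> (forall f g, P f -> P g -> P (f * g)%g) ->
    (forall f, P f -> P f^-1%g) -> (forall y, P (free_gen y)) ->
  forall f, P f.
Proof.
move=> P1 PM PV Pgen [s red_s].
have Pval (f g : free_group Y) : val f = val g -> P f -> P g by move=> /val_inj->.
elim: s red_s => [|[y b] s IHs] red_s; first exact: Pval P1.
have red_s' := path_sorted red_s.
have Pa : P (exist _ [:: (y, b)] isT).
  by case: b {red_s}; [exact: Pgen | exact: Pval (PV _ (Pgen y))].
pose a : free_group Y := exist _ [:: (y, b)] isT.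
(* Multiplying the tail by its head letter merely conses it: the word is reduced, so no cancellation
   occurs. *)
apply: (Pval (a * exist _ s red_s')%g); last by apply: PM => //; exact: IHs.
by rewrite /=; case: s red_s {IHs} red_s' => //= c s /andP[/negPf->].
Qed.

Variables (G : groupType) (phi : Y -> G).

Definition letter_eval (a : Y * bool) : G := if a.2 then phi a.1 else (phi a.1)^-1%g.
Definition word_eval (s : seq (Y * bool)) : G :=
  foldr (fun a g => letter_eval a * g)%g 1%g s.

Lemma letter_eval_inv a : letter_eval (letter_inv a) = (letter_eval a)^-1%g.
Proof. by case: a => y []; rewrite /letter_eval /= ?invgK. Qed.

Lemma word_eval_letter_mul a s :
  word_eval (letter_mul a s) = (letter_eval a * word_eval s)%g.
Proof.
case: s => //= b s; case: eqP => // ->.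
by rewrite letter_eval_inv mulgA mulgV mul1g.
Qed.

Lemma free_group_extM :
  {morph (fun f : free_group Y => word_eval (val f)) : f g / (f * g)%g}.
Proof.
move=> [s hs] [t ht] /=; elim: s {hs} => [|a s IHs] /=; first by rewrite mul1g.
by rewrite word_eval_letter_mul IHs mulgA.
Qed.

Definition free_group_ext : UMagmaMorphism.type (free_group Y) G :=
  morph_pack free_group_extM.

Lemma free_group_ext_gen y : free_group_ext (free_gen y) = phi y.
Proof. exact: mulg1. Qed.
End FreeGroupUniversal.

Lemma free_group_morph_eq (Y : choiceType) (G : groupType)
    (f g : UMagmaMorphism.type (free_group Y) G) :
  (forall y, f (free_gen y) = g (free_gen y)) -> f =1 g.
Proof.
move=> fg; apply: free_group_ind => // [|s t fs ft|s fs].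
- by rewrite !gmulf1.
- by rewrite !gmulfM fs ft.
- by rewrite !gmulfV fs.
Qed.

Section FreeModuleUniversal.
Variables (K : comPzRingType) (X Y : finType).
Implicit Types (p : X * free_group Y) (u v : free_module K X Y).

Fact free_basis_supp p : (fun q => (q == p)%:R : K^o) \in @fin_supp K X Y.
Proof.
apply/asboolP; apply: sub_finite_set (finite_set1 p) => q /=.
by have [->|_] := eqVneq q p; rewrite //= eqxx.
Qed.

Definition free_basis p : free_module K X Y :=
  exist _ (fun q => (q == p)%:R) (free_basis_supp p).

Lemma free_act_basis p g : free_act (free_basis p) g = free_basis (p.1, p.2 * g)%g.
Proof.
apply: val_inj; apply/funext => -[x f] /=; congr (_%:R); congr nat_of_bool.
case: p => y h /=; rewrite !xpair_eqE; congr andb.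
by apply/eqP/eqP => [<-|->]; rewrite -mulgA ?mulVg ?mulgV mulg1.
Qed.

Lemma val_free_sum (I : Type) (s : seq I) (F : I -> free_module K X Y) q :
  val (\sum_(i <- s) F i) q = \sum_(i <- s) val (F i) q.
Proof. by elim/big_rec2: _ => //= i a b _ <-. Qed.

Lemma val_scale_basis k p q : val (k *: free_basis p) q = k * (q == p)%:R.
Proof. by []. Qed.

Lemma free_module_ind (P : free_module K X Y -> Prop) :
    P 0 -> (forall k u v, P u -> P v -> P (k *: u + v)) ->
    (forall p, P (free_basis p)) ->
  forall u, P u.
Proof.
move=> P0 PD Pb u; have /asboolP fin_u := valP u.
have -> : u = \sum_(p <- fset_set [set p | val u p != 0]) val u p *: free_basis p.
  apply: val_inj; apply/funext => q; rewrite val_free_sum.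
  have [u0|nz] := eqVneq (val u q) 0.
    rewrite u0 big1_seq // => p /andP[_]; rewrite in_fset_set // => /set_mem nz.
    rewrite val_scale_basis; have [qp|_] := eqVneq q p; last by rewrite mulr0.
    by move: nz; rewrite -qp /= u0 eqxx.
  rewrite (bigD1_seq q) ?fset_uniq //; last by rewrite in_fset_set // mem_setE.
  rewrite val_scale_basis eqxx mulr1 big1 => [|p pq].
    by rewrite /= addr0.
  by rewrite val_scale_basis eq_sym (negPf pq) mulr0.
elim/big_rec: _ => // p v _ Pv; exact: PD.
Qed.

Section Extension.
Variables (M : lmodType K) (m : X * free_group Y -> M).

(** The terms vanish off the finite support of [u], so this sum over a possibly infinite basis is
    meaningful without choosing an enumeration. *)
Definition free_module_ext_fun u : M := \sum_(p \in [set: X * free_group Y]) val u p *: m p.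

Lemma free_module_ext_seq u (s : seq (X * free_group Y)) :
    uniq s -> (forall p, val u p != 0 -> p \in s) ->
  free_module_ext_fun u = \sum_(p <- s) val u p *: m p.
Proof.
move=> s_uniq us; rewrite fsbig_seq //; apply/esym/fsbig_widen => // p [_ /= ps].
have [->|/us//] := eqVneq (val u p) 0; exact: scale0r.
Qed.

Lemma free_module_ext_linear : linear free_module_ext_fun.
Proof.
move=> k u v; have /asboolP fin_u := valP u; have /asboolP fin_v := valP v.
have fin_uv : finite_set ([set p | val u p != 0] `|` [set p | val v p != 0]).
  by rewrite finite_setU.
(* A single list covering the supports of [u], [v] and [k *: u + v] lets the three sums be compared
   termwise. *)
pose s := fset_set ([set p | val u p != 0] `|` [set p | val v p != 0]).
have us p : val u p != 0 -> p \in enum_fset s.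
  by move=> nz; rewrite in_fset_set //; apply/mem_set; left.
have vs p : val v p != 0 -> p \in enum_fset s.
  by move=> nz; rewrite in_fset_set //; apply/mem_set; right.
rewrite !(@free_module_ext_seq _ s) ?fset_uniq //.
  rewrite scaler_sumr -big_split /=; apply: eq_bigr => p _.
  by rewrite scalerDl -scalerA.
move=> p; have [u0|/us//] := eqVneq (val u p) 0.
have [v0|/vs//] := eqVneq (val v p) 0.
have -> : val (k *: u + v) p = k * val u p + val v p by [].
by rewrite u0 v0 mulr0 addr0 eqxx.
Qed.

Lemma free_module_ext_basis p : free_module_ext_fun (free_basis p) = m p.
Proof.
rewrite (@free_module_ext_seq _ [:: p]) //=.
  by rewrite big_seq1 eqxx scale1r.
by move=> q; have [->|_] := eqVneq q p; rewrite ?mem_head // eqxx.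
Qed.
End Extension.

Section FreeRepExtension.
Variables (R : representation K) (m : X -> rmod R).
Variable beta : UMagmaMorphism.type (free_group Y) (rgrp R).

Let alpha := free_module_ext_fun (fun p => ract R (m p.1) (beta p.2)).

Fact free_rep_ext_act u g : alpha (ract (free_rep K X Y) u g) = ract R (alpha u) (beta g).
Proof.
elim/free_module_ind: u => [|k u v IHu IHv|p].
- have alpha0 : alpha 0 = 0 by exact: (linear0 (linear_pack (free_module_ext_linear _))).
  by rewrite act0 alpha0 act0.
- by rewrite act_linear /alpha !free_module_ext_linear -/alpha act_linear IHu IHv.
- by rewrite /= free_act_basis /alpha !free_module_ext_basis /= gmulfM actM.
Qed.

Definition free_rep_ext : rep_hom (free_rep K X Y) R :=
  @RepHom K (free_rep K X Y) R (linear_pack (free_module_ext_linear _)) beta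
    free_rep_ext_act.

Lemma free_rep_ext_basis x : hmod free_rep_ext (free_basis (x, 1%g)) = m x.
Proof. by rewrite /= free_module_ext_basis gmulf1 act1. Qed.
End FreeRepExtension.

(** Each basis element [x h] is [x] acted on by [h], and [h] is a word in the generators, so
    equivariance determines the module map. *)
Lemma free_rep_hom_eq (R : representation K) (f g : rep_hom (free_rep K X Y) R) :
    (forall y, hgrp f (free_gen y) = hgrp g (free_gen y)) ->
    (forall x, hmod f (free_basis (x, 1%g)) = hmod g (free_basis (x, 1%g))) ->
  hmod f =1 hmod g.
Proof.
move=> /free_group_morph_eq fgG fgX.
apply: free_module_ind => [|k u v IHu IHv|[x h]].
- by rewrite !linear0.
- by rewrite !linearP IHu IHv.
- have -> : free_basis (x, h) = ract (free_rep K X Y) (free_basis (x, 1%g)) h.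
    by rewrite /= free_act_basis mul1g.
  by rewrite !hom_act fgX fgG.
Qed.
End FreeModuleUniversal.

(** * Images and finite generation *)

Definition rep_surj (K : comPzRingType) (R S : representation K) (f : rep_hom R S) : Prop :=
  (forall v, exists u, hmod f u = v) /\ (forall g, exists h, hgrp f h = g).

Section Image.
Variables (K : comPzRingType) (R S : representation K) (f : rep_hom R S).

Definition img_mod : {pred rmod S} := fun v => `[< exists u, hmod f u = v >].
Definition img_grp : {pred rgrp S} := fun g => `[< exists h, hgrp f h = g >].

Fact img_mod_closed : submod_closed img_mod.
Proof.
split=> [|k _ _ /asboolP[u <-] /asboolP[v <-]]; apply/asboolP.
  by exists 0; rewrite linear0.
by exists (k *: u + v); rewrite linearP.
Qed.

HB.instance Definition _ :=
  GRing.isSubmodClosed.Build K (rmod S) img_mod img_mod_closed.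

Fact img_grp1 : 1%g \in img_grp.
Proof. by apply/asboolP; exists 1%g; rewrite gmulf1. Qed.

Fact img_grpV : {in img_grp, forall g, g^-1%g \in img_grp}.
Proof. by move=> _ /asboolP[h <-]; apply/asboolP; exists h^-1%g; rewrite gmulfV. Qed.

Fact img_grpM : {in img_grp &, forall g h, (g * h)%g \in img_grp}.
Proof.
move=> _ _ /asboolP[g <-] /asboolP[h <-].
by apply/asboolP; exists (g * h)%g; rewrite gmulfM.
Qed.

Definition img_grp_closed : groupClosed (rgrp S) :=
  HB.pack img_grp (isMul1Closed.Build (rgrp S) img_grp img_grp1)
    (isMulClosed.Build (rgrp S) img_grp img_grpM)
    (isInvClosed.Build (rgrp S) img_grp img_grpV).

Fact img_stable : act_stable (ract S) img_mod img_grp.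
Proof.
move=> _ _ /asboolP[v <-] /asboolP[g <-].
by apply/asboolP; exists (ract R v g); rewrite hom_act.
Qed.

Definition img_subrep : subrep S := @SubRep K S img_mod img_grp_closed img_stable.
Definition img_rep : representation K := rep_of_subrep img_subrep.

Fact mem_img_mod u : hmod f u \in img_mod.
Proof. by apply/asboolP; exists u. Qed.

Fact mem_img_grp h : hgrp f h \in img_grp.
Proof. by apply/asboolP; exists h. Qed.

Definition corestr_mod (u : rmod R) : rmod img_rep := exist _ (hmod f u) (mem_img_mod u).
Definition corestr_grp (h : rgrp R) : rgrp img_rep := exist _ (hgrp f h) (mem_img_grp h).

Fact corestr_mod_linear : linear corestr_mod.
Proof. by move=> k u v; apply: val_inj; rewrite /= linearP. Qed.

Fact corestr_grpM : {morph corestr_grp : g h / (g * h)%g}.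
Proof. by move=> g h; apply: val_inj; rewrite /= gmulfM. Qed.

Fact corestr_act v h :
  corestr_mod (ract R v h) = ract img_rep (corestr_mod v) (corestr_grp h).
Proof. by apply: val_inj; rewrite /= hom_act. Qed.

Definition corestr : rep_hom R img_rep :=
  hom_pack corestr_mod_linear corestr_grpM corestr_act.

Lemma corestr_surj : rep_surj corestr.
Proof.
split=> [[v hv] | [g hg]].
  by have /asboolP[u fu] := hv; exists u; apply: val_inj.
by have /asboolP[h fh] := hg; exists h; apply: val_inj.
Qed.

Lemma corestr_eq0 u : (hmod corestr u = 0) <-> (hmod f u = 0).
Proof. by split=> [/(congr1 val)|fu0]; last exact: val_inj. Qed.
End Image.

Section FinitelyGenerated.
Variables (K : comPzRingType) (R : representation K).

Lemma rep_surj_fin_gen (X Y : finType) (f : rep_hom (free_rep K X Y) R) :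
  rep_surj f -> fin_gen_rep R.
Proof.
case=> fV fG; split.
  exists [seq hgrp f (free_gen y) | y <- enum Y] => B genB g.
  have {g}[h <-] := fG g; elim/free_group_ind: h => [|g h Bg Bh|h Bh|y].
  - by rewrite gmulf1 gpred1.
  - by rewrite gmulfM gpredM.
  - by rewrite gmulfV gpredV.
  - by apply/genB/map_f; rewrite mem_enum.
exists [seq hmod f (free_basis K (x, 1%g)) | x <- enum X] => A A_act genA v.
have {v}[u <-] := fV v; elim/free_module_ind: u => [|k u v Au Av|[x h]].
- by rewrite linear0 rpred0.
- by rewrite linearP rpredD ?rpredZ.
- have -> : free_basis K (x, h) = ract (free_rep K X Y) (free_basis K (x, 1%g)) h.
    by rewrite /= free_act_basis mul1g.
  by rewrite hom_act; apply: A_act => //; apply/genA/map_f; rewrite mem_enum.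
Qed.

Lemma fin_gen_rep_cover : fin_gen_rep R ->
  exists (X Y : finType) (f : rep_hom (free_rep K X Y) R), rep_surj f.
Proof.
case=> [[s gen_s] [t gen_t]].
(* Positions in the two lists of generators serve as the finite sets [X] and [Y]. *)
pose f := free_rep_ext (tnth (in_tuple t)) (free_group_ext (tnth (in_tuple s))).
exists 'I_(size t), 'I_(size s), f.
have fG g : exists h, hgrp f h = g.
  suff /asboolP : g \in img_grp f by [].
  apply: (gen_s (img_grp_closed f)) => _ /seq_tnthP[i ->].
  by rewrite -(free_group_ext_gen (tnth (in_tuple s)) i); apply: mem_img_grp.
split=> // v; suff /asboolP : v \in img_mod f by [].
(* Stability of the image under the whole group of [R] rests on the surjectivity [fG] just shown. *)
apply: gen_t => [w g Iw _|_ /seq_tnthP[i ->]].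
  by have [h <-] := fG g; apply: img_stable => //; apply: mem_img_grp.
rewrite -(free_rep_ext_basis (tnth (in_tuple t)) (free_group_ext (tnth (in_tuple s))) i).
exact: mem_img_mod.
Qed.
End FinitelyGenerated.

(** * Preservation of implications *)

Section Preservation.
Variables (K : comPzRingType) (X Y : finType).
Variables (T : set (free_module K X Y)) (w : free_module K X Y).
Implicit Types (R S : representation K) (C : rep_class K).

Let valid C := forall R, C R -> nabla2 R T w.

(** If [f] kills [T], so does each composite with [g i]; hence all composites kill [w], and joint
    injectivity gives [hmod f w = 0]. Embeddings, isomorphisms and products are all instances. *)
Lemma nabla2_separated S (I : Type) (F : I -> representation K)
    (g : forall i, rep_hom S (F i)) :
    (forall v, (forall i, hmod (g i) v = 0) -> v = 0) ->
    (forall i, nabla2 (F i) T w) ->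
  nabla2 S T w.
Proof.
move=> sep FT f fT; apply: sep => i.
by apply: (FT i (hom_comp (g i) f)) => u /fT /= ->; rewrite linear0.
Qed.

Lemma nabla2_inj R S (g : rep_hom S R) :
  injective (hmod g) -> nabla2 R T w -> nabla2 S T w.
Proof.
move=> g_inj RT; apply: (@nabla2_separated S unit (fun=> R) (fun=> g)) => // v /(_ tt).
by rewrite -(linear0 (hmod g)) => /g_inj.
Qed.

Lemma nabla2_iso R S : rep_iso S R -> nabla2 R T w -> nabla2 S T w.
Proof. by case=> f [/bij_inj f_inj _]; exact: nabla2_inj f_inj. Qed.

Section Projection.
Variables (I : Type) (F : I -> representation K) (i : I).

Fact proj_linear : linear (fun v : rmod (rep_prod F) => v i : rmod (F i)).
Proof. by []. Qed.

Fact projM : {morph (fun g : rgrp (rep_prod F) => g i : rgrp (F i)) : g h / (g * h)%g}.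
Proof. by []. Qed.

Definition rep_proj : rep_hom (rep_prod F) (F i) :=
  hom_pack proj_linear projM (fun _ _ => erefl).
End Projection.

Section Inclusion.
Variables (S : representation K) (S0 : subrep S).

Fact incl_linear : linear (val : rmod (rep_of_subrep S0) -> rmod S).
Proof. by []. Qed.

Fact inclM : {morph (val : rgrp (rep_of_subrep S0) -> rgrp S) : g h / (g * h)%g}.
Proof. by []. Qed.

Definition rep_incl : rep_hom (rep_of_subrep S0) S :=
  hom_pack incl_linear inclM (fun _ _ => erefl).
End Inclusion.

Lemma nabla2_subrep S (S0 : subrep S) : nabla2 S T w -> nabla2 (rep_of_subrep S0) T w.
Proof. by apply: (nabla2_inj (g := rep_incl S0)); exact: val_inj. Qed.

Lemma nabla2_opC C : valid C -> valid (opC C).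
Proof.
move=> CT S [I [F [CF /nabla2_iso]]]; apply.
apply: (nabla2_separated (g := rep_proj F)) => [v v0|i]; last exact: CT.
by apply: functional_extensionality_dep => i; exact: v0.
Qed.

Lemma nabla2_opS C : valid C -> valid (opS C).
Proof. by move=> CT S [R [R0 [CR /nabla2_iso]]]; apply; apply/nabla2_subrep/CT. Qed.

Lemma nabla2_opQr C : valid C -> valid (opQr C).
Proof.
move=> CT S [D [a [phi [Ca phi_surj aphi]]]] f fT.
(* Freeness of [F(Y)]: lifting the images of the generators through [phi] lifts the whole group map
   to [D], while the module map stays the same. *)
have [lift liftP] := choice (fun y => phi_surj (hgrp f (free_gen y))).
pose beta := free_group_ext lift.
have betaP h : phi (beta h) = hgrp f h.
  apply: (free_group_morph_eq (f := phi \o beta)) => y.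
  by rewrite /= mulg1 liftP.
have f'_act v h : hmod f (ract (free_rep K X Y) v h) = a (hmod f v) (beta h).
  by rewrite hom_act aphi betaP.
exact: (CT _ Ca (@RepHom K (free_rep K X Y) (Representation a) (hmod f) beta f'_act)).
Qed.

Lemma nabla2_opQ0 C : valid C -> valid (opQ0 C).
Proof.
move=> CT S [D [a [phi [Ca _ aphi]]]] f fT.
have f'_act v h : hmod f (ract (free_rep K X Y) v h) = a (hmod f v) (phi (hgrp f h)).
  by rewrite hom_act aphi.
exact: (CT _ Ca (@RepHom K (free_rep K X Y) (Representation a) (hmod f)
  (phi \o hgrp f) f'_act)).
Qed.

Lemma nabla2_opL C : valid C -> valid (opL C).
Proof.
move=> CT S LS f fT; apply/corestr_eq0.
(* The image of [f] is finitely generated, so it lies in [C]; corestricting [f] to it does not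
   change the kernel. *)
have S0T := CT _ (LS _ (rep_surj_fin_gen (corestr_surj f))).
by apply: S0T => u /fT fu0; apply: (corestr_eq0 f u).2.
Qed.

Lemma nabla2_operators R S :
    nabla2 R T w ->
    opL (opQ0 (opQr (opS (opC (class_of_rep R))))) S ->
  nabla2 S T w.
Proof.
move=> RT; apply/nabla2_opL/nabla2_opQ0/nabla2_opQr/nabla2_opS/nabla2_opC.
by move=> {}S /nabla2_iso; apply.
Qed.
End Preservation.

Lemma satisfies_nabla2 (K : comPzRingType) (R : representation K) (q : quasi_identity K) :
  satisfies R q <-> nabla2 R (range (qi_prem q)) (qi_concl q).
Proof.
split=> [Rq f fT | RT f f0].
  by apply: Rq => i; apply: fT; exists i.
by apply: RT => _ [i _ <-].
Qed.

(** * Group action kernels *)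

Section LinearAutomorphisms.
Variables (K : comPzRingType) (V : lmodType K).

(** Elements of [GL(V)] are encoded as pairs of mutually inverse maps, so that inversion is a
    swap. *)
Definition is_lin_aut (p : (V -> V) * (V -> V)) : bool :=
  `[< [/\ linear p.1, cancel p.1 p.2 & cancel p.2 p.1] >].

Definition lin_aut : Type := {p | is_lin_aut p}.

HB.instance Definition _ := [isSub of lin_aut for @sval _ _].
HB.instance Definition _ := [Choice of lin_aut by <:].

Lemma lin_autP (p : lin_aut) :
  [/\ linear (val p).1, cancel (val p).1 (val p).2 & cancel (val p).2 (val p).1].
Proof. exact/asboolP/(valP p). Qed.

Lemma lin_aut_eq (p q : lin_aut) : (val p).1 =1 (val q).1 -> p = q.
Proof.
move=> pq; apply: val_inj; case: p q (lin_autP p) (lin_autP q) pq => [[p p'] ?] [[q q'] ?] /=.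
move=> [_ pK p'K] [_ qK q'K] pq; congr pair; apply/funext => // v.
by rewrite -{1}(q'K v) -pq pK.
Qed.

Fact lin_aut_one_subproof : is_lin_aut (id, id).
Proof. exact/asboolP. Qed.

Fact lin_aut_mul_subproof (p q : lin_aut) :
  is_lin_aut ((val q).1 \o (val p).1, (val p).2 \o (val q).2).
Proof.
have [pL pK p'K] := lin_autP p; have [qL qK q'K] := lin_autP q.
by apply/asboolP; split=> [k u v | |] /=; [rewrite pL qL | exact: can_comp | exact: can_comp].
Qed.

Fact lin_aut_inv_subproof (p : lin_aut) : is_lin_aut ((val p).2, (val p).1).
Proof.
have [pL pK p'K] := lin_autP p; apply/asboolP; split=> //=.
exact: (can2_linear (f := linear_pack pL) pK p'K).
Qed.

(* The product applies [p] first, so that [lin_aut] acts on the right. *)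
Definition lin_aut_one : lin_aut := exist _ (id, id) lin_aut_one_subproof.
Definition lin_aut_mul (p q : lin_aut) : lin_aut :=
  exist _ ((val q).1 \o (val p).1, (val p).2 \o (val q).2) (lin_aut_mul_subproof p q).
Definition lin_aut_inv (p : lin_aut) : lin_aut :=
  exist _ ((val p).2, (val p).1) (lin_aut_inv_subproof p).

Fact lin_aut_mulA : associative lin_aut_mul.
Proof. by move=> p q r; apply: lin_aut_eq. Qed.
Fact lin_aut_mul1 : left_id lin_aut_one lin_aut_mul.
Proof. by move=> p; apply: lin_aut_eq. Qed.
Fact lin_aut_mulr1 : right_id lin_aut_one lin_aut_mul.
Proof. by move=> p; apply: lin_aut_eq. Qed.
Fact lin_aut_mulV : left_inverse lin_aut_one lin_aut_inv lin_aut_mul.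
Proof. by move=> p; apply: lin_aut_eq => v /=; have [_ _ ->] := lin_autP p. Qed.
Fact lin_aut_mulgV : right_inverse lin_aut_one lin_aut_inv lin_aut_mul.
Proof. by move=> p; apply: lin_aut_eq => v /=; have [_ -> _] := lin_autP p. Qed.

HB.instance Definition _ := isGroup.Build lin_aut
  lin_aut_mulA lin_aut_mul1 lin_aut_mulr1 lin_aut_mulV lin_aut_mulgV.

Fact aut_act_linear (p : lin_aut) : linear (val p).1.
Proof. by have [] := lin_autP p. Qed.

Definition aut_act : raction V lin_aut :=
  @RAction K V lin_aut (fun v p => (val p).1 v) aut_act_linear
    (fun=> erefl) (fun _ _ _ => erefl).

Section AutomorphismOfAction.
Variables (G : groupType) (a : raction V G).

Fact act_aut_subproof g : is_lin_aut (a^~ g, a^~ g^-1%g).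
Proof.
apply/asboolP; split=> [|v|v] /=; first exact: act_linear.
- by rewrite -actM mulgV act1.
- by rewrite -actM mulVg act1.
Qed.

Definition act_aut g : lin_aut := exist _ (a^~ g, a^~ g^-1%g) (act_aut_subproof g).

Fact act_autM : {morph act_aut : g h / (g * h)%g}.
Proof. by move=> g h; apply: lin_aut_eq => v; exact: actM. Qed.

(** The group of its image is [G] modulo the kernel of the action. *)
Definition act_aut_hom : rep_hom (Representation a) (Representation aut_act) :=
  hom_pack (R := Representation a) (S := Representation aut_act) (f := id)
    (fun _ _ _ => erefl) act_autM (fun _ _ => erefl).
End AutomorphismOfAction.
End LinearAutomorphisms.

Section Transport.
Variables (K : comPzRingType) (V : lmodType K) (P : representation K).
Variables (gam : {linear V -> rmod P}) (del : {linear rmod P -> V}).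
Hypotheses (gamK : cancel gam del) (delK : cancel del gam).

(** The operators [opQr] and [opQ0] keep the module literally fixed, so an action on an isomorphic
    module must first be carried over to [V]. *)
Definition transport_act_fun v g := del (ract P (gam v) g).

Fact transport_act_linear g : linear (transport_act_fun^~ g).
Proof. by move=> k u v; rewrite /transport_act_fun linearP act_linear linearP. Qed.
Fact transport_act1 v : transport_act_fun v 1%g = v.
Proof. by rewrite /transport_act_fun act1 gamK. Qed.
Fact transport_actM v g h :
  transport_act_fun v (g * h)%g = transport_act_fun (transport_act_fun v g) h.
Proof. by rewrite /transport_act_fun delK actM. Qed.

Definition transport_act : raction V (rgrp P) :=
  RAction transport_act_linear transport_act1 transport_actM.

Fact transport_hom_act v g : gam (transport_act v g) = ract P (gam v) g.
Proof. exact: delK. Qed.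

Lemma transport_iso : rep_iso (Representation transport_act) P.
Proof.
exists (@RepHom K (Representation transport_act) P gam idfun transport_hom_act).
by split; [exists del | exists id].
Qed.
End Transport.

(** By the kernel condition [hmod p] is constant on the fibres of [hmod f], so [hmod p] composed
    with any section of [hmod f] is linear. *)
Lemma rep_surj_factor (K : comPzRingType) (R S P : representation K)
    (f : rep_hom R S) (p : rep_hom R P) :
    rep_surj f -> (forall u, hmod f u = 0 -> hmod p u = 0) ->
  exists gam : {linear rmod S -> rmod P}, forall u, gam (hmod f u) = hmod p u.
Proof.
case=> /choice[s sP] _ fp.
have pE u v : hmod f u = hmod f v -> hmod p u = hmod p v.
  by move=> fuv; apply/subr0_eq; rewrite -linearB fp // linearB fuv subrr.
have gamL : linear (hmod p \o s).
  by move=> k u v; rewrite /= -linearP; apply: pE; rewrite linearP !sP.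
by exists (linear_pack gamL) => u; apply: pE; rewrite sP.
Qed.

(* [S] and [P] have the same module and, after dividing out the kernels of the
   actions, the same group: the image of the group of [R] in [GL (rmod S)]. *)
Lemma opQ0_opQr_same_kernel (K : comPzRingType) (C : rep_class K)
    (R S P : representation K) (f : rep_hom R S) (p : rep_hom R P) :
    rep_surj f -> rep_surj p -> (forall u, hmod f u = 0 <-> hmod p u = 0) ->
    (forall S', rep_iso S' P -> C S') ->
  opQ0 (opQr C) S.
Proof.
move=> f_surj p_surj fp isoC; have [fV fG] := f_surj; have [pV pG] := p_surj.
have [gam gamE] := rep_surj_factor f_surj (fun u => (fp u).1).
have [del delE] := rep_surj_factor p_surj (fun u => (fp u).2).
have gamK : cancel gam del by move=> v; have [u <-] := fV v; rewrite gamE delE.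
have delK : cancel del gam by move=> v; have [u <-] := pV v; rewrite delE gamE.
(* The module of [S] now carries two actions, of the groups of [P] and of [S]; by [a'E] the two
   images of any [h] act on it by the same automorphism. *)
pose a' := transport_act gamK delK.
have a'E h : act_aut a' (hgrp p h) = act_aut (ract S) (hgrp f h).
  apply: lin_aut_eq => v; have [u <-] := fV v.
  by rewrite /= /transport_act_fun gamE -hom_act delE hom_act.
pose i := act_aut_hom (ract S).
pose D := rgrp (img_rep i).
(* Thus the group of [P] also maps into [D], and onto it because both [f] and [p] are surjective on
   groups. *)
have imD g : act_aut a' g \in img_grp i.
  by have [h <-] := pG g; rewrite a'E; apply: (mem_img_grp i).
pose phi' g : D := exist _ (act_aut a' g) (imD g).
have phi'M : {morph phi' : g h / (g * h)%g}.
  by move=> g h; apply: val_inj; exact: act_autM.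
pose aD := RAction (fun d : D => aut_act_linear (val d)) (fun=> erefl) (fun _ _ _ => erefl).
exists D, aD, (hgrp (corestr i)); split=> //; last exact: (corestr_surj i).2.
exists (rgrp P), a', (morph_pack phi'M); split=> // [|d].
  exact/isoC/transport_iso.
have [g <-] := (corestr_surj i).2 d; have [h <-] := fG g.
by exists (hgrp p h); apply: val_inj; exact: a'E.
Qed.

(** * Noetherian representations *)

Section Tupling.
Variables (K : comPzRingType) (I : Type) (S : representation K) (F : I -> representation K).
Variable g : forall i, rep_hom S (F i).

Definition hom_prod_mod (v : rmod S) : rmod (rep_prod F) := fun i => hmod (g i) v.
Definition hom_prod_grp (h : rgrp S) : rgrp (rep_prod F) := fun i => hgrp (g i) h.

Fact hom_prod_linear : linear hom_prod_mod.
Proof. by move=> k u v; apply: functional_extensionality_dep => i; exact: linearP. Qed.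
Fact hom_prodM : {morph hom_prod_grp : h k / (h * k)%g}.
Proof. by move=> h k; apply: functional_extensionality_dep => i; exact: gmulfM. Qed.
Fact hom_prod_act v h :
  hom_prod_mod (ract S v h) = ract (rep_prod F) (hom_prod_mod v) (hom_prod_grp h).
Proof. by apply: functional_extensionality_dep => i; exact: hom_act. Qed.

Definition hom_prod : rep_hom S (rep_prod F) :=
  hom_pack hom_prod_linear hom_prodM hom_prod_act.
End Tupling.

Lemma rep_iso_refl (K : comPzRingType) (R : representation K) : rep_iso R R.
Proof.
exists (@RepHom K R R idfun idfun (fun _ _ => erefl)).
by split; exists id.
Qed.

Section Noetherian.
Variables (K : comPzRingType) (V : representation K).

(** Listing the elements of [T] turns the implication into a genuine quasi-identity of [V]. *)
Lemma qVar_at_finite_nabla2 (S : representation K) (X Y : finType)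
    (T : set (free_module K X Y)) (w : free_module K X Y) :
  qVar_at V S -> finite_set T -> nabla2 V T w -> nabla2 S T w.
Proof.
move=> VS /finite_seqP[s ->] Vw f fs.
pose q := QuasiIdentity (tnth (in_tuple s)) w.
suff Vq : satisfies V q by apply: (VS q Vq f) => i; apply: fs; exact: mem_tnth.
move=> h h0; apply: Vw => _ /seq_tnthP[i ->]; exact: h0.
Qed.

Lemma Noetherian_qVar_opL (S : representation K) :
    action_type_logically_Noetherian V -> qVar_at V S ->
  opL (opQ0 (opQr (opS (opC (class_of_rep V))))) S.
Proof.
move=> noethV VS S0 /fin_gen_rep_cover[X [Y [f f_surj]]].
pose T := [set u | hmod f u = 0].
(* The Noetherian property reduces [T] to a finite [T0]; the implication then passes from [V] to [S]
   and to [S0], where it is tested on [f] itself. *)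
have closedT u : nabla2 V T u -> T u.
  case/noethV=> T0 [T0T finT0 /(qVar_at_finite_nabla2 VS finT0)].
  by move/(nabla2_subrep (S0 := S0)); apply => v /T0T.
(* The power of [V] is indexed by all homomorphisms that kill [T], so the kernel of [F] is
   [nabla2 V T], which equals [T] by [closedT]. *)
pose F := hom_prod (fun i : {h : rep_hom (free_rep K X Y) V | nabla V T h} => sval i).
apply: (opQ0_opQr_same_kernel f_surj (corestr_surj F)) => [u|S' isoS'].
  split=> [fu0|/corestr_eq0 Fu0].
    apply/corestr_eq0; apply: functional_extensionality_dep => -[h hT] /=; exact: hT.
  apply: closedT => h hT; exact: (congr1 (fun v => v (exist _ h hT)) Fu0).
exists (rep_prod (fun _ : {h | nabla V T h} => V)), (img_subrep F); split=> //.
by exists {h | nabla V T h}, (fun=> V); split=> // [_|]; exact: rep_iso_refl.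
Qed.
End Noetherian.

(** * Quotients and consequences *)

Section Quotient.
Variables (K : comPzRingType) (R : representation K) (A : submodClosed (rmod R)).
Hypothesis A_stable : act_stable (ract R) A predT.

(* [submodClosed] does not inherit from [zmodClosed]. *)
Fact submod_zmod_closed : zmod_closed A.
Proof. by split=> [|u v Au Av]; rewrite ?rpred0 // rpredD // -scaleN1r rpredZ. Qed.

Definition submod_zmod : zmodClosed (rmod R) :=
  HB.pack (A : {pred rmod R})
    (GRing.isZmodClosed.Build (rmod R) (A : {pred rmod R}) submod_zmod_closed).

Definition quot_module : Type := Quotient.quot submod_zmod.

HB.instance Definition _ := GRing.Zmodule.on quot_module.

Definition quot_proj (u : rmod R) : quot_module := (\pi_(Quotient.quot submod_zmod) u)%qT.
Definition quot_repr (q : quot_module) : rmod R := repr (q : Quotient.quot submod_zmod).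

Lemma quot_reprK : cancel quot_repr quot_proj.
Proof. exact: reprK. Qed.

Lemma quot_projP u v : reflect (quot_proj u = quot_proj v) (u - v \in A).
Proof.
rewrite [u - v \in A](Quotient.idealrBE submod_zmod u v); exact: eqP.
Qed.

Lemma quot_projD : {morph quot_proj : u v / u + v}.
Proof. exact: (raddfD (\pi_(Quotient.quot submod_zmod))%qT). Qed.

Definition quot_scale (k : K) (q : quot_module) : quot_module :=
  quot_proj (k *: quot_repr q).

Lemma quot_proj_scale k u : quot_proj (k *: u) = quot_scale k (quot_proj u).
Proof.
by apply/quot_projP; rewrite -scalerBr rpredZ //; apply/quot_projP; rewrite quot_reprK.
Qed.

Fact quot_scaleA a b q : quot_scale a (quot_scale b q) = quot_scale (a * b) q.
Proof. by rewrite -[q]quot_reprK -!quot_proj_scale scalerA. Qed.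
Fact quot_scale1 : left_id 1 quot_scale.
Proof. by move=> q; rewrite -[q]quot_reprK -quot_proj_scale scale1r. Qed.
Fact quot_scaleDr : right_distributive quot_scale +%R.
Proof.
move=> k p q; rewrite -[p]quot_reprK -[q]quot_reprK -quot_projD -!quot_proj_scale.
by rewrite -quot_projD scalerDr.
Qed.
Fact quot_scaleDl q : {morph quot_scale^~ q : a b / a + b}.
Proof.
by move=> a b; rewrite -[q]quot_reprK -!quot_proj_scale scalerDl quot_projD.
Qed.

HB.instance Definition _ := GRing.Zmodule_isLmodule.Build K quot_module
  quot_scaleA quot_scale1 quot_scaleDr quot_scaleDl.

Fact quot_proj_linear : linear quot_proj.
Proof. by move=> k u v; rewrite quot_projD quot_proj_scale. Qed.

Definition quot_act_fun (q : quot_module) g : quot_module :=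
  quot_proj (ract R (quot_repr q) g).

Lemma quot_proj_act u g : quot_proj (ract R u g) = quot_act_fun (quot_proj u) g.
Proof.
apply/quot_projP; rewrite -(linearB (linear_pack (act_linear (ract R) g))) /=.
by apply: A_stable => //; apply/quot_projP; rewrite quot_reprK.
Qed.

Fact quot_act_linear g : linear (quot_act_fun^~ g).
Proof.
move=> k p q; rewrite -[p]quot_reprK -[q]quot_reprK -quot_proj_linear -!quot_proj_act.
by rewrite act_linear quot_proj_linear.
Qed.
Fact quot_act1 q : quot_act_fun q 1%g = q.
Proof. by rewrite -[q]quot_reprK -quot_proj_act act1. Qed.
Fact quot_actM q g h : quot_act_fun q (g * h)%g = quot_act_fun (quot_act_fun q g) h.
Proof. by rewrite -[q]quot_reprK -!quot_proj_act actM. Qed.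

(** Only the module is divided. The group stays that of [R], hence free when [R] is a free
    representation. *)
Definition quot_rep : representation K :=
  Representation (RAction quot_act_linear quot_act1 quot_actM).

Definition quot_pi : rep_hom R quot_rep :=
  @RepHom K R quot_rep (linear_pack quot_proj_linear) idfun quot_proj_act.

Lemma quot_pi_eq0 u : hmod quot_pi u = 0 <-> u \in A.
Proof.
rewrite -(linear0 (hmod quot_pi)) -{2}[u]subr0.
by split=> /quot_projP.
Qed.
End Quotient.

Section Consequences.
Variables (K : comPzRingType) (V : representation K) (X Y : finType).
Variable T : set (free_module K X Y).

Definition consequences : {pred rmod (free_rep K X Y)} := fun w =>
  `[< exists T0, [/\ T0 `<=` T, finite_set T0 & nabla2 V T0 w] >].

Lemma nabla2_mono (T1 T2 : set (free_module K X Y)) :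
  T1 `<=` T2 -> nabla2 V T1 `<=` nabla2 V T2.
Proof. by move=> T12 w Tw f fT2; apply: Tw => u /T12; exact: fT2. Qed.

Fact consequences_closed : submod_closed consequences.
Proof.
split=> [|k u v /asboolP[Tu [TuT fin_u Vu]] /asboolP[Tv [TvT fin_v Vv]]]; apply/asboolP.
  by exists set0; split=> // f _; exact: linear0.
(* A combination of two consequences follows from the union of their finite premise sets. *)
exists (Tu `|` Tv); split; [by rewrite subUset | by rewrite finite_setU |] => f fT /=.
rewrite linearP (nabla2_mono (@subsetUl _ Tu Tv) Vu fT).
by rewrite (nabla2_mono (@subsetUr _ Tu Tv) Vv fT) scaler0 addr0.
Qed.

HB.instance Definition _ :=
  GRing.isSubmodClosed.Build K (rmod (free_rep K X Y)) consequences consequences_closed.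

Fact consequences_stable : act_stable (ract (free_rep K X Y)) consequences predT.
Proof.
move=> w g /asboolP[T0 [T0T fin_T0 Vw]] _; apply/asboolP; exists T0; split=> // f fT.
by rewrite /= hom_act (Vw f fT) act0.
Qed.

Definition consequence_rep : representation K :=
  @quot_rep K (free_rep K X Y) consequences consequences_stable.

Definition consequence_proj : rep_hom (free_rep K X Y) consequence_rep :=
  @quot_pi K (free_rep K X Y) consequences consequences_stable.

Lemma consequence_proj_eq0 w :
  hmod consequence_proj w = 0 <->
  exists T0, [/\ T0 `<=` T, finite_set T0 & nabla2 V T0 w].
Proof. by rewrite quot_pi_eq0; split=> /asboolP. Qed.

Lemma consequence_rep_qVar : qVar_at V consequence_rep.
Proof.
move=> q Vq f f_prem.
(* To lift [f] through the projection, choose representatives of the images of [X]; the group map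
   already lands in [F(Y)] and is kept. *)
pose m x := quot_repr (hmod f (free_basis K (x, 1%g))).
pose f' := free_rep_ext (R := free_rep K X Y) m (hgrp f).
have f'E : hmod (hom_comp consequence_proj f') =1 hmod f.
  apply: free_rep_hom_eq => // x.
  rewrite [LHS](congr1 (hmod consequence_proj) (free_rep_ext_basis m (hgrp f) x)) /=.
  exact: quot_reprK.
have /choice[T0 T0P] i : exists T0,
    [/\ T0 `<=` T, finite_set T0 & nabla2 V T0 (hmod f' (qi_prem q i))].
  by apply/consequence_proj_eq0; rewrite -(f_prem i) -f'E.
rewrite -f'E; apply/consequence_proj_eq0.
(* There are finitely many premises, so the union is finite. Any [h] into [V] killing it kills the
   lifted premises, and [Vq] applied to [h] after [f'] yields the conclusion. *)
exists (\bigcup_i T0 i); split=> [u [i _]||h hT].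
- by have [+ _ _] := T0P i; apply.
- by apply: bigcup_finite => // i _; have [] := T0P i.
apply: (Vq (hom_comp h f')) => i; have [_ _] := T0P i; apply.
by move=> u T0u; apply: hT; exists i.
Qed.
End Consequences.

Theorem theorem6p2 (K : comPzRingType) (V : representation K) :
  (forall S : representation K,
     opL (opQ0 (opQr (opS (opC (class_of_rep V))))) S <-> qVar_at V S)
  <-> action_type_logically_Noetherian V.
Proof.
split=> [VE X Y T w Vw | noethV S].
  have /VE/(nabla2_operators Vw) Sw := @consequence_rep_qVar K V X Y T.
  apply/consequence_proj_eq0; apply: Sw => u Tu.
  (* Each [u] in [T] is a consequence of itself alone, so the projection kills [T] and therefore
     [w]. *)
  apply/consequence_proj_eq0; exists [set u].
  by split; [move=> _ -> | exact: finite_set1 | move=> f; apply].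
(* A quasi-identity is an implication whose [T] is the range of its premises, so the operators
   preserve it. *)
split=> [LS q /satisfies_nabla2 Vq|]; last exact: Noetherian_qVar_opL.
exact/satisfies_nabla2/(nabla2_operators Vq LS).
Qed.
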